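(* Let $n,k\ge 1$ be integers, let $\zeta=e^{2\pi i/2^k}$, and let $g_j:\mathbb F_{2^n}\to\mathbb F_2$, $0\le j\le k-1$, be Boolean functions with $g_j(0)=0$ for all $j$ and $$\sum_{t\in\mathbb F_{2^n}}\zeta^{\sum_{j=0}^{k-1}2^jg_j(t)}=0.$$ Let $f:\mathbb F_{2^n}\times\mathbb F_{2^n}\to\mathbb Z_{2^k}$ be given by $$f(y',y)=\sum_{j=0}^{k-1}2^jg_j\!\left(\frac{y'}{y}\right),$$ with the convention $\frac{y'}{y}=0$ if $y=0$. Let $\omega$ be any element of $\mathbb F_{2^{2n}}\setminus\mathbb F_{2^n}$, and regard $f$ as a function $\mathbb F_{2^{2n}}\to\mathbb Z_{2^k}$ through the identification $(y',y)\mapsto x=y'+\omega y$ of $\mathbb F_{2^n}\times\mathbb F_{2^n}$ with $\mathbb F_{2^{2n}}$. Then $f$ is g-hyperbent.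
   Context: Values of Boolean functions are read as the integers $0,1$ when multiplied by powers of $2$ and added in $\mathbb Z_{2^k}$ or in exponents of $\zeta$. For a function $F:\mathbb F_{2^N}\to\mathbb Z_{2^k}$ and an integer $i\geq 1$ with $\gcd(i,2^N-1)=1$, the extended generalized Walsh-Hadamard transform is $$\mathcal H^{(2^k)}_{F,i}(u)=\sum_{x\in\mathbb F_{2^N}}\zeta_{2^k}^{F(x)}(-1)^{\mathrm{Tr}_N(ux^i)},\qquad u\in\mathbb F_{2^N},$$ where $\zeta_{2^k}=e^{2\pi i/2^k}$ and $\mathrm{Tr}_N:\mathbb F_{2^N}\to\mathbb F_2$ is the absolute trace. $F$ is called g-hyperbent (generalized hyperbent) if $|\mathcal H^{(2^k)}_{F,i}(u)|=2^{N/2}$ for all $u\in\mathbb F_{2^N}$ and all integers $i\ge1$ with $\gcd(i,2^N-1)=1$. Here $N=2n$. *)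

(* Defs.v *)
From HB Require Import structures.
From mathcomp Require Import all_boot all_order all_algebra all_fingroup all_field.
From mathcomp Require Import complex.
From mathcomp Require Import reals exp trigo.

Set Implicit Arguments.
Unset Strict Implicit.
Unset Printing Implicit Defensive.

Import Order.TTheory GRing.Theory Num.Theory.
Local Open Scope ring_scope.

(* The complex numbers are [R[i]] for an arbitrary [R : realType].  The field
   with 2^N elements is any finFieldType [L] with [#|L| = 2 ^ N]. *)

Definition zeta (R : realType) (m : nat) : R[i] :=
  (cos (2 * pi / m%:R) +i* sin (2 * pi / m%:R))%C.

Section AbsoluteTrace.
Variables (L : finFieldType) (N : nat).

Definition trace_sum (x : L) : L := \sum_(i < N) x ^+ (2 ^ i).

(* The trace sum lies in the prime subfield {0, 1} of L when #|L| = 2 ^ N; this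
   is its value read in 'F_2 (see [abs_traceE]). *)
Definition abs_trace (x : L) : 'F_2 := if trace_sum x == 0 then 0 else 1.

Lemma abs_traceE (x : L) :
  #|L| = (2 ^ N)%N -> (abs_trace x : nat)%:R = trace_sum x.
Proof.
move=> oL; have ch2 : 2%N \in [pchar L] by apply: (card_finPcharP oL).
have sq : trace_sum x ^+ 2 = trace_sum x.
  rewrite -(pFrobenius_autE ch2) /trace_sum rmorph_sum /=.
  have xN : x ^+ (2 ^ N) = x by rewrite -oL expf_card.
  under eq_bigr => i _ do rewrite pFrobenius_autE -exprM -expnSr.
  case: N xN => [|n] xN; first by rewrite !big_ord0.
  by rewrite big_ord_recr /= xN big_ord_recl /= addrC.
rewrite /abs_trace; case: eqP => [->|/eqP nz] //=.
by apply: (mulfI nz); rewrite -expr2 sq mulr1.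
Qed.

End AbsoluteTrace.

(* Elements of 'Z_(2 ^ k) and of 'F_2 used as exponents are coerced to their
   least natural representatives.  Note that 'Z_(2 ^ k) is Z_{2^k} only for
   k >= 1 ('Z_1 is Z_2 in MathComp). *)
Definition walsh_hadamard (R : realType) (L : finFieldType) (N k : nat)
    (F : L -> 'Z_(2 ^ k)) (i : nat) (u : L) : R[i] :=
  \sum_(x : L) zeta R (2 ^ k) ^+ F x * (-1) ^+ abs_trace N (u * x ^+ i).

Definition g_hyperbent (R : realType) (L : finFieldType) (N k : nat)
    (F : L -> 'Z_(2 ^ k)) : Prop :=
  forall (i : nat) (u : L), (1 <= i)%N -> coprime i (2 ^ N - 1) ->
    `| walsh_hadamard R N F i u | = ((2 `^ (N%:R / 2))%:C)%C.

(* Division by zero yields zero in MathComp, so y' / y = 0 when y = 0. *)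
Definition spread_fun (K : finFieldType) (k : nat) (g : 'I_k -> K -> 'F_2)
    (y' y : K) : 'Z_(2 ^ k) :=
  \sum_(j < k) (2 ^ j * g j (y' / y))%:R.

(* The identification of F_{2^n} x F_{2^n} with F_{2^{2n}}, where [iota] embeds
   F_{2^n} as a subfield of F_{2^{2n}}. *)
Definition identification (K L : finFieldType) (iota : {rmorphism K -> L})
    (omega : L) (p : K * K) : L := iota p.1 + omega * iota p.2.

Lemma identification_bij (K L : finFieldType) (n : nat)
    (iota : {rmorphism K -> L}) (omega : L) :
  #|K| = (2 ^ n)%N -> #|L| = (2 ^ (2 * n))%N -> omega \notin codom iota ->
  bijective (identification iota omega).
Proof.
move=> oK oL womega; apply: inj_card_bij; last first.
  by rewrite oL card_prod oK -expnD mul2n addnn.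
move=> [a b] [c d]; rewrite /identification /= => E.
have {}E : omega * iota (b - d) = iota (c - a).
  rewrite !rmorphB mulrBr; apply/eqP.
  by rewrite subr_eq addrAC eq_sym subr_eq -E addrC.
have [bd|nbd] := eqVneq b d.
  move/eqP: E; rewrite bd subrr rmorph0 mulr0 eq_sym fmorph_eq0 subr_eq0.
  by move/eqP->.
case/negP: womega; apply/codomP; exists ((c - a) / (b - d)).
by rewrite fmorph_div -E mulfK // fmorph_eq0 subr_eq0.
Qed.

(* Main.v *)
(* Write q = 2^n.  The function f vanishes on the line K (y = 0) and is constant
   on K^* (t + omega) for each t in K, and since i is coprime to q^2 - 1 the
   power x |-> x^i permutes both L and K.  Hence the character sum
   of (-1)^Tr(u x^i) over x in the line K a is q or 0 according to whether
   Tr(u a^i K) vanishes.  Using g(0) = 0 and the vanishing of the sum of zeta^g,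
   the transform at u is q times the sum of zeta^g over the "trivial" lines, K
   itself counting with weight 1.  For u != 0 the full sum over L of
   (-1)^Tr(u x^i) is 0, and expanding it over the q + 1 lines shows that exactly
   one of them is trivial; for u = 0 all are. *)
Require Import Defs.
From HB Require Import structures.
From mathcomp Require Import all_boot all_order all_algebra all_fingroup all_field.
From mathcomp Require Import complex.
From mathcomp Require Import reals exp trigo.
Set Implicit Arguments.
Unset Strict Implicit.
Unset Printing Implicit Defensive.
Import Order.TTheory GRing.Theory Num.Theory.
Local Open Scope ring_scope.

Section RootOfUnity.
Variable R : realType.

Lemma zeta_expE (m j : nat) :
  zeta R m ^+ j = (cos (2 * pi / m%:R *+ j) +i* sin (2 * pi / m%:R *+ j))%C.
Proof.
elim: j => [|j IHj]; first by rewrite expr0 mulr0n cos0 sin0.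
rewrite exprS IHj !(mulrS _ j) cosD sinD /zeta; apply/eqP; rewrite eq_complex /=.
by rewrite (addrC (_ * sin _)) !eqxx.
Qed.

Lemma zeta_exp_order (m : nat) : (0 < m)%N -> zeta R m ^+ m = 1.
Proof.
move=> m_gt0; rewrite zeta_expE -[_ *+ m]mulr_natr divfK ?pnatr_eq0 ?lt0n_neq0 //.
by rewrite mulr_natl cos2pi sin2pi.
Qed.

Lemma normr_zeta (m : nat) : (0 < m)%N -> `|zeta R m| = 1.
Proof.
move=> m_gt0; apply/eqP; rewrite -(pexpr_eq1 m_gt0) ?normr_ge0 //.
by rewrite -normrX zeta_exp_order // normr1.
Qed.

Lemma zeta_exp_Zp (m j : nat) :
  (1 < m)%N -> zeta R m ^+ ((j%:R : 'Z_m) : nat) = zeta R m ^+ j.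
Proof.
by move=> m_gt1; rewrite val_Zp_nat // expr_mod // zeta_exp_order // ltnW.
Qed.

End RootOfUnity.

(** If [psi v != 1], translating the summation variable by [v] multiplies the sum by [psi v], so the
    sum must be 0. *)
Lemma sum_character (V : finZmodType) (C : numDomainType) (psi : V -> C) :
    (forall x y, psi (x + y) = psi x * psi y) -> psi 0 = 1 ->
  \sum_x psi x = if [forall x, psi x == 1] then #|V|%:R else 0.
Proof.
move=> psiD psi0; case: forallP => [psi1 | /forallP].
  under eq_bigr => x _ do rewrite (eqP (psi1 x)).
  by rewrite sumr_const.
rewrite negb_forall => /existsP[v psi_v].
have : psi v * (\sum_x psi x) = \sum_x psi x.
  rewrite [RHS](reindex_inj (addrI v)) mulr_sumr.
  by apply: eq_bigr => x _; rewrite psiD.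
move/eqP; rewrite -subr_eq0 -{2}[\sum_x _]mul1r -mulrBl mulf_eq0 subr_eq0.
by rewrite (negPf psi_v) => /eqP.
Qed.

(** For [y != 0], equal powers make [x / y] a root of unity of order dividing both [i] and
    [#|F|.-1], so Bézout gives [x / y = 1]. *)
Lemma coprime_expf_inj (F : finFieldType) (i : nat) :
  (0 < i)%N -> coprime i #|F|.-1 -> injective (fun x : F => x ^+ i).
Proof.
move=> i_gt0 co x y /= xy.
have [y0 | y_neq0] := eqVneq y 0.
  move: xy; rewrite y0 expr0n gtn_eqF // => /eqP.
  by rewrite expf_eq0 i_gt0 => /eqP.
have zi1 : (x / y) ^+ i = 1 by rewrite expr_div_n xy divff // expf_neq0.
have z_neq0 : x / y != 0.
  by apply: contra_eq_neq zi1 => ->; rewrite expr0n gtn_eqF // eq_sym oner_neq0.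
have zq1 : (x / y) ^+ #|F|.-1 = 1.
  apply: (mulfI z_neq0); rewrite -exprS prednK ?expf_card ?mulr1 //.
  by apply/card_gt0P; exists 0.
have [a b ab _] := egcdnP #|F|.-1 i_gt0.
rewrite (eqP co) in ab.
have /(congr1 (fun j => (x / y) ^+ j)) := ab.
rewrite mulnC exprM zi1 expr1n mulnC exprD exprM zq1 expr1n mul1r expr1.
move=> /esym z1.
by rewrite -[x](divfK y_neq0) z1 mul1r.
Qed.

Section Trace.
Variables (L : finFieldType) (N : nat).
Hypothesis cardL : #|L| = (2 ^ N)%N.

Lemma trace_sumD (x y : L) :
  trace_sum N (x + y) = trace_sum N x + trace_sum N y.
Proof.
have ch2 : 2%N \in [pchar L] by apply: (card_finPcharP cardL).
rewrite /trace_sum -big_split /=; apply: eq_bigr => j _.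
by rewrite exprDn_pchar // pnatX pnatE ?ch2.
Qed.

(** The trace is a polynomial function of degree [2 ^ (N - 1)], too small for it to vanish at all
    [2 ^ N] elements. *)
Lemma trace_sum_nontrivial : (0 < N)%N -> exists x : L, trace_sum N x != 0.
Proof.
case: N cardL => // m cardLm _; apply/existsP; apply: contraPT (leqnn #|L|).
rewrite negb_exists => /forallP tr0.
pose p : {poly L} := \sum_(j < m.+1) 'X^(2 ^ j).
have p_root x : root p x.
  rewrite /root /p horner_sum; under eq_bigr do rewrite hornerXn.
  by have := tr0 x; rewrite negbK.
have size_p : size p = (2 ^ m).+1.
  rewrite /p big_ord_recr /= addrC size_polyDl size_polyXn // ltnS.
  apply: (leq_trans (size_sum _ _ _)); apply/bigmax_leqP => j _.
  by rewrite size_polyXn ltn_exp2l.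
have p_neq0 : p != 0 by rewrite -size_poly_eq0 size_p.
apply/negP; rewrite -ltnNge cardLm.
have := max_poly_roots p_neq0 (rs := enum L).
rewrite -cardE cardLm size_p ltnS enum_uniq leqNgt ltn_exp2l // ltnSn /=.
by move=> /(_ _ isT) contra; exfalso; apply/notF/contra/allP => x _; exact: p_root.
Qed.

Variable C : numDomainType.

Definition trace_char (x : L) : C := (-1) ^+ abs_trace N x.

Lemma trace_char0 : trace_char 0 = 1.
Proof.
rewrite /trace_char /abs_trace /trace_sum big1 ?eqxx ?expr0 // => j _.
by rewrite expr0n expn_eq0.
Qed.

Lemma trace_charD (x y : L) :
  trace_char (x + y) = trace_char x * trace_char y.
Proof.
have ch2 : 2%N \in [pchar L] by apply: (card_finPcharP cardL).
have tr01 (z : L) : (trace_sum N z == 0) || (trace_sum N z == 1).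
  rewrite -(abs_traceE z cardL) /abs_trace.
  by case: ifP => _ /=; rewrite ?eqxx ?orbT.
rewrite /trace_char /abs_trace trace_sumD.
case/orP: (tr01 x) => /eqP->; case/orP: (tr01 y) => /eqP->;
  by rewrite ?addr0 ?add0r ?addrr_pchar2 ?eqxx ?oner_eq0 /=
             ?mul1r ?mulr1 ?mulrNN ?mulr1.
Qed.

Lemma sum_trace_char : (0 < N)%N -> \sum_x trace_char x = 0.
Proof.
move=> N_gt0; rewrite (sum_character trace_charD trace_char0).
case: forallP => // /= tr1; have [x tr_x] := trace_sum_nontrivial N_gt0.
have := tr1 x; rewrite /trace_char /abs_trace (negPf tr_x) expr1.
by rewrite lt_eqF // (lt_trans (ltrN10 C) ltr01).
Qed.

End Trace.

(* The q + 1 lines through the origin of L, a K-plane: the line K itself (the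
   infinite slope y = 0) and the lines spanned by t + omega. *)
Lemma sum_spread (K L : finFieldType) (n : nat) (iota : {rmorphism K -> L})
    (omega : L) (V : zmodType) (h : L -> V) :
    #|K| = (2 ^ n)%N -> #|L| = (2 ^ (2 * n))%N -> omega \notin codom iota ->
  \sum_x h x = \sum_y h (iota y) +
     \sum_t \sum_(y | y != 0) h (iota y * (iota t + omega)).
Proof.
move=> cardK cardL omega_notin.
rewrite (reindex (identification iota omega)) /=; last first.
  exact/onW_bij/(identification_bij cardK cardL omega_notin).
transitivity (\sum_y \sum_y' h (iota y' + omega * iota y)).
  by rewrite exchange_big pair_bigA; apply: eq_bigr => -[].
rewrite (bigD1 0) //=; congr (_ + _).
  by apply: eq_bigr => y _; rewrite rmorph0 mulr0 addr0.
rewrite [RHS]exchange_big /=; apply: eq_bigr => y y_neq0.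
(* For fixed [y != 0], substitute [y' = y * t], so that [y' + omega * y] becomes
   [y * (t + omega)]. *)
rewrite (reindex_inj (mulfI y_neq0)) /=; apply: eq_bigr => t _.
by rewrite rmorphM mulrDr [omega * _]mulrC.
Qed.

Theorem theorem3p2 (R : realType) (n k : nat) (n_ge1 : (1 <= n)%N) (k_ge1 : (1 <= k)%N)
    (K L : finFieldType) (cardK : #|K| = (2 ^ n)%N) (cardL : #|L| = (2 ^ (2 * n))%N)
    (iota : {rmorphism K -> L})
    (g : 'I_k -> K -> 'F_2)
    (g_at0 : forall j : 'I_k, g j 0 = 0)
    (g_sum0 : \sum_(t : K) zeta R (2 ^ k) ^+ (\sum_(j < k) 2 ^ j * g j t)%N = 0)
    (omega : L) (omega_notin : omega \notin codom iota)
    (f : L -> 'Z_(2 ^ k))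
    (f_def : forall y' y : K, f (identification iota omega (y', y)) = spread_fun g y' y) :
  g_hyperbent R (2 * n) f.
Proof.
move=> i u i_ge1 co_i; rewrite /walsh_hadamard.
set z := zeta R (2 ^ k); pose psi := @trace_char L (2 * n) R[i].
pose G t := (\sum_(j < k) 2 ^ j * g j t)%N.
pose q : R[i] := (2 ^ n)%:R.
have q_neq0 : q != 0 by rewrite pnatr_eq0 expn_eq0.
have k2_gt1 : (1 < 2 ^ k)%N by rewrite -{1}(expn0 2) ltn_exp2l.
have psiD : {morph psi : x y / x + y >-> x * y} by apply: trace_charD.
have psi0 : psi 0 = 1 by apply: trace_char0.
have zf y' y : z ^+ f (iota y' + omega * iota y) = z ^+ G (y' / y).
  have -> : f (iota y' + omega * iota y) = spread_fun g y' y by rewrite -f_def.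
  by rewrite /spread_fun -natr_sum zeta_exp_Zp.
have G0 : G 0 = 0%N by rewrite /G big1 // => j _; rewrite g_at0 muln0.
have expL_inj : injective (fun x : L => x ^+ i).
  by apply: coprime_expf_inj; rewrite // cardL -subn1.
have expK_inj : injective (fun x : K => x ^+ i).
  apply: coprime_expf_inj; rewrite // cardK -subn1; apply: coprime_dvdr co_i.
  (* Coprimality passes from L to K because q - 1 divides q^2 - 1 = (q - 1)(q + 1). *)
  have sub_sqr := subn_sqr (2 ^ n) 1; rewrite exp1n -expnM mulnC in sub_sqr.
  by rewrite sub_sqr dvdn_mulr.
pose trivial_on_line (v : L) := [forall y : K, psi (v * iota y) == 1].
have sum_line v : \sum_y psi (v * iota y) = if trivial_on_line v then q else 0.
  rewrite (@sum_character K R[i] (fun y => psi (v * iota y))) ?cardK //.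
  - by move=> x y; rewrite rmorphD mulrDr psiD.
  - by rewrite rmorph0 mulr0.
(* The power map sends the line K a onto the line K a^i, permuting the scalars by [y |-> y ^+ i]. *)
have sum_lineX a : \sum_y psi (u * (iota y * a) ^+ i) =
    if trivial_on_line (u * a ^+ i) then q else 0.
  rewrite -sum_line [RHS](reindex_inj expK_inj) /=.
  by apply: eq_bigr => y _; rewrite rmorphXn exprMn -mulrA [a ^+ i * _]mulrC.
have sum_lineX_neq0 a : \sum_(y | y != 0) psi (u * (iota y * a) ^+ i) =
    (if trivial_on_line (u * a ^+ i) then q else 0) - 1.
  rewrite -sum_lineX [in RHS](bigD1 0) //= rmorph0 mul0r expr0n gtn_eqF //.
  by rewrite mulr0 psi0 addrAC subrr add0r.
have sum_lineX1 : \sum_y psi (u * iota y ^+ i) =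
    if trivial_on_line u then q else 0.
  transitivity (\sum_y psi (u * (iota y * 1) ^+ i)).
    by apply: eq_bigr => y _; rewrite mulr1.
  by rewrite sum_lineX expr1n mulr1.
pose b t := trivial_on_line (u * (iota t + omega) ^+ i).
have WE : \sum_x z ^+ f x * psi (u * x ^+ i) =
    q * ((trivial_on_line u)%:R + \sum_t z ^+ G t * (b t)%:R).
  rewrite (sum_spread _ cardK cardL omega_notin) mulrDr; congr (_ + _).
    rewrite mulr_natr mulrb -sum_lineX1; apply: eq_bigr => y _.
    (* The convention y' / 0 = 0 makes the exponent [G 0 = 0] on all of K. *)
    have := zf y 0; rewrite rmorph0 mulr0 addr0 => ->.
    by rewrite invr0 mulr0 G0 expr0 mul1r.
  transitivity (\sum_t z ^+ G t * (q * (b t)%:R - 1)).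
    apply: eq_bigr => t _; rewrite mulr_natr mulrb -sum_lineX_neq0 mulr_sumr.
    apply: eq_bigr => y y_neq0; congr (_ * _).
    by rewrite mulrDr -rmorphM [_ * omega]mulrC zf mulrAC divff ?mul1r.
  (* The terms -1, one for the origin removed from each line, are weighted by [z ^+ G t] and so
     cancel by [g_sum0]. *)
  rewrite mulr_sumr; under eq_bigr do rewrite mulrBr mulr1 mulrCA.
  by rewrite sumrB g_sum0 subr0.
have -> : ((2 `^ ((2 * n)%:R / 2))%:C)%C = q.
  rewrite natrM mulrAC divff ?pnatr_eq0 // mul1r powR_mulrn ?ler0n //.
  by rewrite /q natrX rmorphXn /= rmorph_nat.
rewrite [X in `|X|]WE normrM normr_nat -[RHS]mulr1; congr (_ * _).
(* It remains to see that the cofactor of q has modulus 1. For [u = 0] every line is trivial and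
   [g_sum0] leaves only the 1 coming from K. *)
have [u0 | u_neq0] := eqVneq u 0.
  have triv0 : trivial_on_line 0 by apply/forallP => y; rewrite mul0r psi0 eqxx.
  rewrite u0 triv0 (eq_bigr (fun t => z ^+ G t)) ?g_sum0 ?addr0 ?normr1 // => t _.
  by rewrite /b u0 mul0r triv0 mulr1.
(* The count is done in [R[i]], where it can be compared with a vanishing character sum. *)
have count_lines : (trivial_on_line u + \sum_t b t = 1)%N.
  apply/eqP; rewrite -(eqr_nat R[i]) natrD natr_sum; apply/eqP.
  have : \sum_x psi (u * x ^+ i) = 0.
    have psi_sum0 : \sum_x psi x = 0.
      by rewrite (sum_trace_char cardL) // muln_gt0.
    rewrite -[RHS]psi_sum0.
    by rewrite [RHS](reindex_inj (inj_comp (mulfI u_neq0) expL_inj)).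
  rewrite (sum_spread _ cardK cardL omega_notin) sum_lineX1.
  under [in X in _ + X]eq_bigr do rewrite sum_lineX_neq0.
  (* Here the removed origins have equal weight: they total -q, so q times the number of trivial
     lines equals q. *)
  rewrite sumrB sumr_const cardK addrA => /eqP; rewrite subr_eq0 => /eqP E.
  apply: (mulfI q_neq0); rewrite mulr1 -[RHS]E mulrDr mulr_natr mulrb mulr_sumr.
  by congr (_ + _); apply: eq_bigr => t _; rewrite mulr_natr mulrb.
(* The cofactor is 1 if the trivial line is K, and otherwise a single power of [z]. *)
case triv_u: (trivial_on_line u) count_lines.
  move/eqP; rewrite -[X in _ == X]addn0 eqn_add2l sum_nat_eq0 => /forallP b0.
  rewrite big1 ?addr0 ?normr1 // => t _.
  by have /eqP-> := b0 t; rewrite mulr0.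
rewrite add0n => /eqP/sum_nat_eq1[t [_ bt b0]].
rewrite add0r (bigD1 t) //= big1 => [|s s_neq_t].
  by rewrite bt mulr1 addr0 normrX normr_zeta ?expr1n // ltnW.
by rewrite b0 // mulr0.
Qed.
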